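(* Let $a<b$ be real numbers and let $f:[a,b]\to\mathbb{R}^{+}$ be multiplicatively differentiable on $[a,b]$. If $f^{\ast}$ is multiplicatively integrable on $[a,b]$, then $$f\left(\tfrac{a+b}{2}\right)\left(\int_{a}^{b} f(u)^{du}\right)^{\frac{1}{a-b}}=\left(\int_{0}^{1}\left(f^{\ast}\left((1-t)a+t\tfrac{a+b}{2}\right)^{t}\right)^{dt}\right)^{\frac{b-a}{4}}\left(\int_{0}^{1}\left(f^{\ast}\left((1-t)\tfrac{a+b}{2}+tb\right)^{t-1}\right)^{dt}\right)^{\frac{b-a}{4}}.$$
   Context: $\mathbb{R}^{+}$ denotes the positive real numbers. For a positive function $f$, the multiplicative derivative at $t$ is $f^{\ast}(t)=\lim_{h\to 0}\left(\frac{f(t+h)}{f(t)}\right)^{1/h}$ (one-sided limits at endpoints of the interval); $f$ is multiplicatively differentiable on $[a,b]$ if this limit exists as a positive real number at every $t\in[a,b]$. If $f$ is positive and differentiable at $t$, then $f^{\ast}(t)=e^{(\ln f(t))'}=e^{f'(t)/f(t)}$. The multiplicative integral of a positive function $g$ on $[c,d]$ is $\int_{c}^{d} (g(t))^{dt}=\exp\left(\int_{c}^{d}\ln g(t)\,dt\right)$, where the right-hand integral is a Riemann integral; $g$ is multiplicatively integrable on $[c,d]$ if $\ln g$ is Riemann integrable there. An expression $f^{\ast}(x)^{s}$ means $(f^{\ast}(x))^{s}$. *)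

(* Defs.v *)
From Stdlib Require Import Reals.
From Coquelicot Require Import Coquelicot.
Open Scope R_scope.

(* [l] is the multiplicative derivative at [t] of a positive function [f] on
   [a, b].  The increment [h] is nonzero and keeps [t + h] in [a, b], so the
   limit is two-sided inside the interval and one-sided at its endpoints, and
   the values of [f] outside [a, b] are irrelevant. *)
Definition is_mderive (a b : R) (f : R -> R) (t l : R) : Prop :=
  0 < l /\
  filterlim (fun h => Rpower (f (t + h) / f t) (1 / h))
    (within (fun h => a <= t + h <= b) (locally' 0)) (locally l).

Definition ex_mderive (a b : R) (f : R -> R) (t : R) : Prop :=
  exists l : R, is_mderive a b f t l.

(* Unspecified where [ex_mderive a b f t] fails. *)
Definition mderive (a b : R) (f : R -> R) (t : R) : R :=
  iota (is_mderive a b f t).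

(* Intended for [c <= d]: positivity is only asked on [c, d]. *)
Definition ex_mint (g : R -> R) (c d : R) : Prop :=
  (forall t : R, c <= t <= d -> 0 < g t) /\ ex_RInt (fun t => ln (g t)) c d.

Definition mint (g : R -> R) (c d : R) : R :=
  exp (RInt (fun t => ln (g t)) c d).

(* Main.v *)
Require Import Defs.
From Stdlib Require Import Reals Lra Lia.
From Coquelicot Require Import Coquelicot.
Open Scope R_scope.

(** Write [F = ln f], [p = ln f*] and [m = (a + b) / 2].  Taking logarithms
    turns multiplicative calculus into ordinary calculus: [F' = p], and the
    identity becomes

      [F m - 1/(b-a) * int_a^b F = (b-a)/4 * (int_0^1 t p((1-t)a + t m) dt
                                   + int_0^1 (t-1) p((1-t)m + t b) dt)].

    Each integral on the right is evaluated by parts after an affine change of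
    variable: the weight [t] vanishes at [a], the weight [t - 1] vanishes at
    [b], so that only the boundary terms at [m] survive, and the two remaining
    integrals of [F] over [a, m] and [m, b] add up to the one over [a, b].

    The delicate point is that [p] is only Riemann integrable, not continuous.
    Integration by parts then rests on two facts: the integral of an integrable
    derivative is the increment of the primitive
    ([is_RInt_derive_of_ex_RInt], obtained from Riemann sums whose tags are
    mean value points), and a continuous function times an integrable one is
    integrable ([ex_RInt_continuous_mult], obtained by uniform approximation).
    Applied to the derivative [F x + (x - k) * p x] of [(x - k) * F x] they give
    [is_RInt_affine_weight_derive].

    At the end points of [a, b] the function [F] is only one-sidedly
    differentiable, and [f] is arbitrary outside; composing [f] with the
    projection [clamp] onto [a, b] yields a function that is continuous at
    every point of [a, b] in the two-sided sense. *)

(** * The integral of an integrable derivative *)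

(** With the mean value point of each cell as its tag, the Riemann sum of the
    derivative telescopes exactly, however coarse the mesh.  The end point [b]
    is kept fixed and cells are added on the left, which matches [SF_cons]. *)
Lemma MVT_tagged_subdivision (F p : R -> R) (b h : R) (n : nat) :
  0 <= h ->
  (forall x, b - INR n * h <= x <= b -> continuity_pt F x) ->
  (forall x, b - INR n * h < x < b -> is_derive F x (p x)) ->
  exists s : SF_seq,
    pointed_subdiv s /\ SF_h s = b - INR n * h /\
    seq.last (SF_h s) (SF_lx s) = b /\
    seq_step (SF_lx s) <= h /\
    Riemann_sum p s = F b - F (b - INR n * h).
Proof.
intros Hh; induction n as [|n IH]; intros Hc Hd.
- exists (SF_nil b); simpl.
  split; [|split; [|split; [|split]]].
  + intros i Hi; unfold SF_size in Hi; simpl in Hi; lia.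
  + lra.
  + reflexivity.
  + unfold seq_step; simpl; lra.
  + unfold Riemann_sum; simpl; unfold zero; simpl.
    replace (b - 0 * h) with b by ring; ring.
- rewrite S_INR in Hc, Hd |- *.
  assert (Hn := pos_INR n).
  assert (Hnh : 0 <= INR n * h) by nra.
  destruct IH as (s & Hs & Hsh & Hsl & Hst & HsR).
  { intros x Hx; apply Hc; lra. }
  { intros x Hx; apply Hd; lra. }
  set (c := b - (INR n + 1) * h) in *.
  set (c' := b - INR n * h) in *.
  assert (Hcc : c' = c + h) by (unfold c, c'; ring).
  destruct (MVT_gen F c c' p) as (y & Hy & HF).
  { intros x; rewrite Rmin_left, Rmax_right by lra.
    intros Hx; apply Hd; unfold c' in *; lra. }
  { intros x; rewrite Rmin_left, Rmax_right by lra.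
    intros Hx; apply Hc; unfold c' in *; lra. }
  rewrite Rmin_left, Rmax_right in Hy by lra.
  exists (SF_cons (c, y) s).
  split; [|split; [|split; [|split]]].
  + intros i Hi; rewrite SF_size_cons in Hi.
    destruct i as [|i]; simpl.
    * change (c <= y <= SF_h s); lra.
    * apply Hs; lia.
  + reflexivity.
  + rewrite SF_lx_cons; simpl; exact Hsl.
  + rewrite SF_lx_cons; unfold seq_step; simpl.
    apply Rmax_lub.
    * rewrite Hsh, Rabs_pos_eq; lra.
    * exact Hst.
  + rewrite Riemann_sum_cons, HsR, Hsh; simpl.
    unfold plus, scal; simpl; unfold mult; simpl; lra.
Qed.

(** Since the limit of Riemann sums is assumed to exist, it can be computed
    along the subdivisions of [MVT_tagged_subdivision], where the sums are
    constant. *)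
Lemma is_RInt_derive_of_ex_RInt (F p : R -> R) (a b : R) :
  a < b ->
  (forall x, a <= x <= b -> continuity_pt F x) ->
  (forall x, a < x < b -> is_derive F x (p x)) ->
  ex_RInt p a b ->
  is_RInt p a b (F b - F a).
Proof.
intros Hab Hc Hd [I HI].
replace (F b - F a) with I; [exact HI|].
apply cond_eq.
intros eps Heps.
destruct (HI _ (locally_ball I (mkposreal eps Heps))) as [delta Hdelta].
destruct (nfloor_ex ((b - a) / delta)) as [n Hn].
{ apply Rdiv_le_0_compat; [lra|apply cond_pos]. }
set (h := (b - a) / INR (S n)).
assert (Hn1 : 0 < INR (S n)) by (apply lt_0_INR; lia).
assert (Hd0 := cond_pos delta).
assert (Hh : 0 <= h) by (apply Rdiv_le_0_compat; lra).
assert (Hhd : h < delta).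
{ unfold h; apply Rlt_div_l; [lra|].
  destruct Hn as [_ Hn]; apply Rlt_div_l in Hn; [|lra].
  rewrite S_INR; lra. }
assert (Hnh : b - INR (S n) * h = a) by (unfold h; field; lra).
destruct (MVT_tagged_subdivision F p b h (S n)) as (s & Hs & Hsh & Hsl & Hst & HsR).
{ exact Hh. }
{ rewrite Hnh; exact Hc. }
{ rewrite Hnh; exact Hd. }
rewrite Hnh in *.
assert (Hball := Hdelta s (Rle_lt_trans _ _ _ Hst Hhd)).
rewrite Rmin_left, Rmax_right in Hball by lra.
specialize (Hball (conj Hs (conj Hsh Hsl))).
rewrite sign_eq_1 in Hball by lra.
change (Rabs (1 * Riemann_sum p s - I) < eps) in Hball.
rewrite HsR in Hball.
rewrite Rabs_minus_sym.
rewrite Rmult_1_l in Hball.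
exact Hball.
Qed.

(** * Products of integrable and continuous functions *)

(** Cauchy criterion: Riemann sums of [f] and of a uniformly close [g] differ
    by at most [(b - a)] times the uniform distance, so the Riemann sums of [f]
    oscillate barely more than the convergent ones of [g]. *)
Lemma ex_RInt_unif_approx (f : R -> R) (a b : R) :
  a < b ->
  (forall eps : posreal, exists g : R -> R,
     ex_RInt g a b /\ forall x, a <= x <= b -> Rabs (f x - g x) <= eps) ->
  ex_RInt f a b.
Proof.
intros Hab H.
apply (filterlim_locally_cauchy (F := Riemann_fine a b)
  (fun s => scal (sign (b - a)) (Riemann_sum f s))).
intros eps.
assert (Heps := cond_pos eps).
assert (He1 : 0 < eps / 4 / (b - a)) by (apply Rdiv_lt_0_compat; lra).
destruct (H (mkposreal _ He1)) as [g [[I HI] Hg]]; simpl in Hg.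
(* Comparing two sums of [f] costs a quarter of [eps] four times: twice from
   [f] to [g] and twice from [g] to its integral. *)
assert (He2 : 0 < eps / 4) by lra.
exists (fun s => (pointed_subdiv s /\ SF_h s = Rmin a b /\
    seq.last (SF_h s) (SF_lx s) = Rmax a b) /\
  ball I (mkposreal _ He2) (scal (sign (b - a)) (Riemann_sum g s))).
split.
- apply filter_and.
  + exists eps; intros s _ Hs; exact Hs.
  + apply HI, locally_ball.
- assert (Hsum : forall s, pointed_subdiv s /\ SF_h s = Rmin a b /\
      seq.last (SF_h s) (SF_lx s) = Rmax a b ->
      Rabs (Riemann_sum f s - Riemann_sum g s) <= eps / 4).
  { rewrite Rmin_left, Rmax_right by lra.
    intros s (Hs & Hsh & Hsl).
    assert (B : Rabs (Riemann_sum (fun x => f x - g x) s) <=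
      Riemann_sum (fun _ => eps / 4 / (b - a)) s).
    { apply (Riemann_sum_norm (V := R_NormedModule)); [exact Hs|].
      rewrite Hsl, Hsh; exact Hg. }
    assert (E : Riemann_sum (fun x => f x - g x) s =
      Riemann_sum f s - Riemann_sum g s) by exact (Riemann_sum_minus f g s).
    rewrite E, Riemann_sum_const, Hsl, Hsh in B.
    replace (eps / 4) with (scal (b - a) (eps / 4 / (b - a))).
    2: { unfold scal; simpl; unfold mult; simpl; field; lra. }
    exact B. }
  intros u v [Hu Bu] [Hv Bv].
  apply Hsum in Hu; apply Hsum in Hv; clear Hsum.
  rewrite sign_eq_1 in * by lra.
  unfold ball in *; simpl in *.
  unfold AbsRing_ball, abs, minus, plus, opp, scal in *; simpl in *.
  unfold mult in *; simpl in *.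
  revert Hu Hv Bu Bv; unfold Rabs; repeat destruct Rcase_abs; lra.
Qed.

(** On the cells of a fine grid [w] is nearly constant, and the product of [p]
    with a function constant on each cell is integrable cell by cell; as [p] is
    bounded, the error is uniformly small. *)
Lemma ex_RInt_continuous_mult (w p : R -> R) (a b : R) :
  a < b ->
  (forall x, a <= x <= b -> continuity_pt w x) ->
  ex_RInt p a b ->
  ex_RInt (fun x => w x * p x) a b.
Proof.
intros Hab Hw Hp.
destruct (ex_RInt_ub p a b Hp) as [M HM].
rewrite Rmin_left, Rmax_right in HM by lra.
assert (HM0 : 0 <= M).
{ apply Rle_trans with (2 := HM a (conj (Rle_refl _) (Rlt_le _ _ Hab))).
  apply norm_ge_0. }
apply ex_RInt_unif_approx; [exact Hab|]; intros eps.
assert (Heps := cond_pos eps).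
(* [M + 1] rather than [M], which may vanish. *)
assert (He : 0 < eps / (M + 1)) by (apply Rdiv_lt_0_compat; lra).
destruct (Heine_cor2 Hw (mkposreal _ He)) as [delta Hdelta]; simpl in Hdelta.
assert (Hd0 := cond_pos delta).
destruct (nfloor_ex ((b - a) / delta)) as [n Hn].
{ apply Rdiv_le_0_compat; lra. }
set (h := (b - a) / INR (S n)).
assert (Hn1 : 0 < INR (S n)) by (apply lt_0_INR; lia).
assert (Hh : 0 < h) by (apply Rdiv_lt_0_compat; lra).
assert (Hhd : h < delta).
{ unfold h; apply Rlt_div_l; [lra|].
  destruct Hn as [_ Hn]; apply Rlt_div_l in Hn; [|lra].
  rewrite S_INR; lra. }
assert (Hgrid : forall k : nat, (k <= S n)%nat -> exists g : R -> R,
  ex_RInt g a (a + INR k * h) /\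
  forall x, a <= x <= a + INR k * h -> Rabs (w x * p x - g x) <= eps).
{ assert (Hend : forall k : nat, (k <= S n)%nat -> a + INR k * h <= b).
  { intros k Hk; apply le_INR in Hk.
    apply Rle_trans with (a + INR (S n) * h); [nra|].
    right; unfold h; field; lra. }
  assert (Hcell : forall x y, a <= y <= b -> y <= x <= y + h -> x <= b ->
    Rabs (w x * p x - w y * p x) <= eps).
  { intros x y Hy Hxy Hxb.
    replace (w x * p x - w y * p x) with ((w x - w y) * p x) by ring.
    rewrite Rabs_mult.
    assert (Hwxy : Rabs (w x - w y) < eps / (M + 1)).
    { apply Hdelta; try lra. rewrite Rabs_pos_eq; lra. }
    assert (Hpx : Rabs (p x) <= M) by (apply HM; lra).
    apply Rle_trans with (eps / (M + 1) * (M + 1)).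
    - apply Rmult_le_compat; try apply Rabs_pos; lra.
    - right; field; lra. }
  induction k as [|k IH]; intros Hk.
  - exists (fun x => w x * p x); simpl.
    rewrite Rmult_0_l, Rplus_0_r; split.
    + apply ex_RInt_point.
    + intros x _; rewrite Rminus_diag, Rabs_R0; lra.
  - destruct IH as [g [Hg Hgx]]; [lia|].
    assert (Hb := Hend (S k) Hk).
    rewrite S_INR in Hb |- *.
    assert (Hk0 := pos_INR k).
    set (y := a + INR k * h) in *.
    replace (a + (INR k + 1) * h) with (y + h) in * by (unfold y; ring).
    assert (Hay : a <= y) by (unfold y; nra).
    exists (fun x => if Rle_dec x y then g x else w y * p x).
    split.
    + apply ex_RInt_Chasles with y.
      * apply ex_RInt_ext with (2 := Hg); intros x Hx.
        rewrite Rmin_left, Rmax_right in Hx by lra.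
        destruct (Rle_dec x y); [reflexivity|lra].
      * apply ex_RInt_ext with (fun x => scal (w y) (p x)).
        { intros x Hx.
          rewrite Rmin_left, Rmax_right in Hx by lra.
          destruct (Rle_dec x y); [lra|reflexivity]. }
        apply (ex_RInt_scal (V := R_NormedModule)).
        apply (ex_RInt_Chasles_1 (V := R_CompleteNormedModule)) with b; [lra|].
        apply (ex_RInt_Chasles_2 (V := R_CompleteNormedModule)) with a; [lra|].
        exact Hp.
    + intros x Hx.
      destruct (Rle_dec x y); [apply Hgx; lra|].
      apply Hcell; lra. }
destruct (Hgrid (S n) (le_n _)) as [g Hg].
exists g.
replace (a + INR (S n) * h) with b in Hg by (unfold h; field; lra).
exact Hg.
Qed.

(** * Integration by parts against an affine weight *)

(** Integration by parts: [F x + (x - k) * p x] is the derivative of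
    [(x - k) * F x], and it is integrable because both terms are. *)
Lemma is_RInt_affine_weight_derive (F p : R -> R) (a b k : R) :
  a < b ->
  (forall x, a <= x <= b -> continuity_pt F x) ->
  (forall x, a < x < b -> is_derive F x (p x)) ->
  ex_RInt p a b ->
  is_RInt (fun x => (x - k) * p x) a b
    ((b - k) * F b - (a - k) * F a - RInt F a b).
Proof.
intros Hab Hc Hd Hp.
assert (HF : ex_RInt F a b).
{ apply (ex_RInt_continuous (V := R_CompleteNormedModule)).
  rewrite Rmin_left, Rmax_right by lra.
  intros x Hx; apply continuity_pt_filterlim, Hc, Hx. }
assert (Hw : forall x, a <= x <= b -> continuity_pt (fun x => x - k) x).
{ intros x _; apply continuity_pt_minus; [apply continuity_pt_id|].
  apply continuity_pt_const; intros ? ?; reflexivity. }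
assert (Hwp := ex_RInt_continuous_mult (fun x => x - k) p a b Hab Hw Hp).
assert (H : is_RInt (fun x => F x + (x - k) * p x) a b
   ((b - k) * F b - (a - k) * F a)).
{ apply (is_RInt_derive_of_ex_RInt (fun x => (x - k) * F x)).
  - exact Hab.
  - intros x Hx; apply (continuity_pt_mult (fun x => x - k)); auto.
  - intros x Hx.
    replace (F x + (x - k) * p x) with (plus (mult 1 (F x)) (mult (x - k) (p x)))
      by (unfold plus, mult; simpl; ring).
    apply (is_derive_mult (fun x => x - k)).
    + auto_derive; [exact I|ring].
    + apply Hd, Hx.
    + intros; apply Rmult_comm.
  - apply (ex_RInt_plus (V := R_NormedModule)); assumption. }
apply is_RInt_ext with (fun x => minus (F x + (x - k) * p x) (F x)).
{ intros x _; unfold minus, plus, opp; simpl; ring. }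
apply (is_RInt_minus (V := R_NormedModule)); [exact H|].
apply (RInt_correct (V := R_CompleteNormedModule)), HF.
Qed.

(** The previous formula transported to [0, 1] by [t |-> (1 - t) c + t d]; the
    zero [s] of the weight corresponds to [k = c + s (d - c)], and one factor
    [d - c] comes from the weight, another from the change of variable. *)
Lemma is_RInt_unit_affine_weight_derive (F p : R -> R) (c d s : R) :
  c < d ->
  (forall x, c <= x <= d -> continuity_pt F x) ->
  (forall x, c < x < d -> is_derive F x (p x)) ->
  ex_RInt p c d ->
  is_RInt (fun t => (t - s) * p ((1 - t) * c + t * d)) 0 1
    (((1 - s) * F d + s * F c - RInt F c d / (d - c)) / (d - c)).
Proof.
intros Hcd Hc Hd Hp.
assert (H := is_RInt_affine_weight_derive F p c d (c + s * (d - c)) Hcd Hc Hd Hp).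
set (k := c + s * (d - c)) in H.
assert (Hlin : is_RInt (fun t => scal (d - c) (((d - c) * t + c - k) * p ((d - c) * t + c)))
  0 1 ((d - k) * F d - (c - k) * F c - RInt F c d)).
{ apply (is_RInt_comp_lin (V := R_NormedModule) (fun x => (x - k) * p x)).
  rewrite Rmult_0_r, Rplus_0_l, Rmult_1_r.
  replace (d - c + c) with d by ring.
  exact H. }
apply (is_RInt_scal (V := R_NormedModule)) with (k := / (d - c) ^ 2) in Hlin.
match type of Hlin with is_RInt _ _ _ ?v =>
  replace (((1 - s) * F d + s * F c - RInt F c d / (d - c)) / (d - c)) with v end.
- apply is_RInt_ext with (2 := Hlin); intros t _.
  replace ((1 - t) * c + t * d) with ((d - c) * t + c) by ring.
  unfold k, scal; simpl; unfold mult; simpl; field; lra.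
- unfold k, scal; simpl; unfold mult; simpl; field; lra.
Qed.

(** * From multiplicative to ordinary derivatives *)

(** The logarithm of [(f (t + h) / f t) ^ (1 / h)] is the difference quotient
    of [ln f], and [ln] is continuous at the positive limit [l].  The restriction
    [a <= t + h <= b] makes this usable both inside [a, b] and at its ends. *)
Lemma is_mderive_ln_quotient (a b : R) (f : R -> R) (t l : R) :
  (forall x, a <= x <= b -> 0 < f x) ->
  a <= t <= b ->
  is_mderive a b f t l ->
  forall eps, 0 < eps -> exists delta : posreal, forall h,
    h <> 0 -> Rabs h < delta -> a <= t + h <= b ->
    Rabs ((ln (f (t + h)) - ln (f t)) / h - ln l) < eps.
Proof.
intros Hpos Ht [Hl Hlim] eps Heps.
assert (Hln := filterlim_comp _ _ _ _ _ _ _ _ Hlim (continuous_ln l Hl)).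
destruct (Hln _ (locally_ball (ln l) (mkposreal eps Heps))) as [delta Hdelta].
exists delta; intros h Hh0 Hh Hth.
assert (Hball : ball 0 delta h).
{ change (Rabs (h - 0) < delta); rewrite Rminus_0_r; exact Hh. }
specialize (Hdelta h Hball Hh0 Hth).
change (Rabs (ln (Rpower (f (t + h) / f t) (1 / h)) - ln l) < eps) in Hdelta.
unfold Rpower in Hdelta.
rewrite ln_exp, ln_div in Hdelta by (apply Hpos; assumption).
replace ((ln (f (t + h)) - ln (f t)) / h) with
  (1 / h * (ln (f (t + h)) - ln (f t))) by (field; exact Hh0).
exact Hdelta.
Qed.

Lemma is_mderive_unique (a b : R) (f : R -> R) (t l l' : R) :
  a < b -> a <= t <= b ->
  is_mderive a b f t l -> is_mderive a b f t l' -> l = l'.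
Proof.
intros Hab Ht [_ H] [_ H'].
refine (@filterlim_locally_unique R R_AbsRing R_NormedModule _ _ _ l l' H H').
constructor.
(* The filter is not trivial: since [a < b], small nonzero increments towards
   the farther end of the interval are admissible. *)
- intros [delta Hdelta].
  assert (Hd := cond_pos delta).
  assert (Hm : 0 < Rmin (delta / 2) ((b - a) / 2)) by (apply Rmin_glb_lt; lra).
  assert (Hm1 := Rmin_l (delta / 2) ((b - a) / 2)).
  assert (Hm2 := Rmin_r (delta / 2) ((b - a) / 2)).
  set (h := Rmin (delta / 2) ((b - a) / 2)) in *.
  destruct (Rle_dec t ((a + b) / 2)) as [Hle | Hgt].
  + apply (Hdelta h); [|lra|lra].
    change (Rabs (h - 0) < delta); rewrite Rabs_pos_eq; lra.
  + apply (Hdelta (- h)); [|lra|lra].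
    change (Rabs (- h - 0) < delta); rewrite Rminus_0_r, Rabs_Ropp, Rabs_pos_eq; lra.
- apply within_filter; apply within_filter; apply locally_filter.
Qed.

Lemma mderive_correct (a b : R) (f : R -> R) (t : R) :
  a < b -> a <= t <= b -> ex_mderive a b f t ->
  is_mderive a b f t (mderive a b f t).
Proof.
intros Hab Ht [l Hl].
apply (iota_correct (V := R_CompleteNormedModule) (is_mderive a b f t)).
exists l; split; [exact Hl|].
intros l' Hl'; exact (is_mderive_unique a b f t l l' Hab Ht Hl Hl').
Qed.

Definition clamp (a b x : R) : R := Rmax a (Rmin x b).

Lemma clamp_in (a b x : R) : a <= b -> a <= clamp a b x <= b.
Proof.
intros Hab; unfold clamp; split; [apply Rmax_l|].
apply Rmax_lub; [exact Hab|apply Rmin_r].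
Qed.

Lemma clamp_id (a b x : R) : a <= x <= b -> clamp a b x = x.
Proof.
intros [Ha Hb]; unfold clamp.
rewrite Rmin_left by exact Hb; apply Rmax_right, Ha.
Qed.

Lemma clamp_dist (a b t x : R) :
  a <= t <= b -> Rabs (clamp a b x - t) <= Rabs (x - t).
Proof.
intros Ht; unfold clamp, Rmax, Rmin, Rabs.
repeat (destruct Rle_dec || destruct Rcase_abs); lra.
Qed.

(** As [clamp] does not increase distances to points of [a, b], continuity
    follows from the bound [|ln l| + 1] on the difference quotients of [ln f]
    near [t], which holds at the end points as well. *)
Lemma continuity_pt_ln_clamp (a b : R) (f : R -> R) (t l : R) :
  (forall x, a <= x <= b -> 0 < f x) ->
  a <= t <= b ->
  is_mderive a b f t l ->
  continuity_pt (fun x => ln (f (clamp a b x))) t.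
Proof.
intros Hpos Ht Hl.
destruct (is_mderive_ln_quotient a b f t l Hpos Ht Hl 1 Rlt_0_1) as [delta Hq].
apply continuity_pt_filterlim, filterlim_locally; intros eps.
assert (Heps := cond_pos eps).
assert (HL := Rabs_pos (ln l)).
assert (He : 0 < eps / (Rabs (ln l) + 1)) by (apply Rdiv_lt_0_compat; lra).
assert (Hm : 0 < Rmin delta (eps / (Rabs (ln l) + 1))).
{ apply Rmin_glb_lt; [apply cond_pos|exact He]. }
exists (mkposreal _ Hm); intros x Hx.
change (Rabs (x - t) < Rmin delta (eps / (Rabs (ln l) + 1))) in Hx.
change (Rabs (ln (f (clamp a b x)) - ln (f (clamp a b t))) < eps).
rewrite (clamp_id a b t Ht).
assert (Hin := clamp_in a b x (Rle_trans _ _ _ (proj1 Ht) (proj2 Ht))).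
assert (Hdist := clamp_dist a b t x Ht).
assert (Hx1 := Rlt_le_trans _ _ _ Hx (Rmin_l _ _)).
assert (Hx2 := Rlt_le_trans _ _ _ Hx (Rmin_r _ _)).
set (h := clamp a b x - t) in *.
replace (clamp a b x) with (t + h) in * by (unfold h; ring).
destruct (Req_dec h 0) as [H0 | H0].
{ rewrite H0, Rplus_0_r, Rminus_diag, Rabs_R0; exact Heps. }
specialize (Hq h H0 (Rle_lt_trans _ _ _ Hdist Hx1) Hin).
replace (ln (f (t + h)) - ln (f t)) with
  ((ln (f (t + h)) - ln (f t)) / h * h) by (field; exact H0).
set (q := (ln (f (t + h)) - ln (f t)) / h) in *.
rewrite Rabs_mult.
assert (Hq1 : Rabs q <= Rabs (ln l) + 1).
{ replace q with (ln l + (q - ln l)) by ring.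
  apply Rle_trans with (1 := Rabs_triang _ _); lra. }
apply Rle_lt_trans with ((Rabs (ln l) + 1) * Rabs h).
{ apply Rmult_le_compat_r; [apply Rabs_pos|exact Hq1]. }
rewrite Rmult_comm; apply Rlt_div_r; lra.
Qed.

Lemma is_derive_ln_clamp (a b : R) (f : R -> R) (t l : R) :
  (forall x, a <= x <= b -> 0 < f x) ->
  a < t < b ->
  is_mderive a b f t l ->
  is_derive (fun x => ln (f (clamp a b x))) t (ln l).
Proof.
intros Hpos Ht Hl.
assert (Ht' : a <= t <= b) by lra.
apply is_derive_Reals; intros eps Heps.
destruct (is_mderive_ln_quotient a b f t l Hpos Ht' Hl eps Heps) as [delta Hq].
assert (Hm : 0 < Rmin delta (Rmin (t - a) (b - t))).
{ repeat apply Rmin_glb_lt; [apply cond_pos|lra|lra]. }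
exists (mkposreal _ Hm); simpl; intros h H0 Hh.
assert (Hh1 := Rlt_le_trans _ _ _ Hh (Rmin_l _ _)).
assert (Hh2 := Rlt_le_trans _ _ _ Hh (Rmin_r _ _)).
assert (Hh3 := Rlt_le_trans _ _ _ Hh2 (Rmin_l _ _)).
assert (Hh4 := Rlt_le_trans _ _ _ Hh2 (Rmin_r _ _)).
apply Rabs_def2 in Hh3; apply Rabs_def2 in Hh4.
rewrite !clamp_id by lra.
apply Hq; [exact H0|exact Hh1|lra].
Qed.

(** * The midpoint identity *)

Theorem lemma3p1 (a b : R) (f : R -> R)
  (hab : a < b)
  (hpos : forall x : R, a <= x <= b -> 0 < f x)
  (hdiff : forall t : R, a <= t <= b -> ex_mderive a b f t)
  (hint : ex_mint (mderive a b f) a b) :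
  let g1 := fun t : R =>
    Rpower (mderive a b f ((1 - t) * a + t * ((a + b) / 2))) t in
  let g2 := fun t : R =>
    Rpower (mderive a b f ((1 - t) * ((a + b) / 2) + t * b)) (t - 1) in
  (ex_mint f a b /\ ex_mint g1 0 1 /\ ex_mint g2 0 1) /\
  f ((a + b) / 2) * Rpower (mint f a b) (1 / (a - b)) =
    Rpower (mint g1 0 1) ((b - a) / 4) * Rpower (mint g2 0 1) ((b - a) / 4).
Proof.
intros g1 g2.
set (F := fun x => ln (f (clamp a b x))).
set (p := fun x => ln (mderive a b f x)).
set (m := (a + b) / 2) in *.
assert (Hm : a < m < b) by (unfold m; lra).
assert (Hder : forall t, a <= t <= b -> is_mderive a b f t (mderive a b f t)).
{ intros t Ht; apply mderive_correct; auto. }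
assert (Hc : forall x, a <= x <= b -> continuity_pt F x).
{ intros x Hx; apply continuity_pt_ln_clamp with (mderive a b f x); auto. }
assert (Hd : forall x, a < x < b -> is_derive F x (p x)).
{ intros x Hx; apply is_derive_ln_clamp; auto; apply Hder; lra. }
assert (Hp : ex_RInt p a b) by apply hint.
assert (Hpam : ex_RInt p a m).
{ apply (ex_RInt_Chasles_1 (V := R_CompleteNormedModule)) with b; [lra|exact Hp]. }
assert (Hpmb : ex_RInt p m b).
{ apply (ex_RInt_Chasles_2 (V := R_CompleteNormedModule)) with a; [lra|exact Hp]. }
assert (HF : ex_RInt F a b).
{ apply (ex_RInt_continuous (V := R_CompleteNormedModule)).
  rewrite Rmin_left, Rmax_right by lra.
  intros x Hx; apply continuity_pt_filterlim, Hc, Hx. }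
assert (HFam : ex_RInt F a m).
{ apply (ex_RInt_Chasles_1 (V := R_CompleteNormedModule)) with b; [lra|exact HF]. }
assert (HFmb : ex_RInt F m b).
{ apply (ex_RInt_Chasles_2 (V := R_CompleteNormedModule)) with a; [lra|exact HF]. }
assert (HFf : forall x, Rmin a b < x < Rmax a b -> F x = ln (f x)).
{ intros x; rewrite Rmin_left, Rmax_right by lra; intros Hx.
  unfold F; rewrite clamp_id by lra; reflexivity. }
assert (H1 : is_RInt (fun t => ln (g1 t)) 0 1
   ((F m - RInt F a m / (m - a)) / (m - a))).
{ (* The weight [t] vanishes at the left end: [s = 0]. *)
  replace (F m) with ((1 - 0) * F m + 0 * F a) by ring.
  apply is_RInt_ext with (fun t => (t - 0) * p ((1 - t) * a + t * m)).
  - intros t _; unfold g1, Rpower; rewrite ln_exp, Rminus_0_r; reflexivity.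
  - apply is_RInt_unit_affine_weight_derive; try lra; auto;
      intros x Hx; [apply Hc|apply Hd]; lra. }
assert (H2 : is_RInt (fun t => ln (g2 t)) 0 1
   ((F m - RInt F m b / (b - m)) / (b - m))).
{ (* The weight [t - 1] vanishes at the right end: [s = 1]. *)
  replace (F m) with ((1 - 1) * F b + 1 * F m) by ring.
  apply is_RInt_ext with (fun t => (t - 1) * p ((1 - t) * m + t * b)).
  - intros t _; unfold g2, Rpower; rewrite ln_exp; reflexivity.
  - apply is_RInt_unit_affine_weight_derive; try lra; auto;
      intros x Hx; [apply Hc|apply Hd]; lra. }
split; [split; [|split]; split|].
- exact hpos.
- apply ex_RInt_ext with (2 := HF); exact HFf.
- intros t _; apply exp_pos.
- eexists; exact H1.
- intros t _; apply exp_pos.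
- eexists; exact H2.
- unfold mint.
  rewrite (is_RInt_unique _ _ _ _ H1), (is_RInt_unique _ _ _ _ H2).
  rewrite <- (RInt_ext F (fun t => ln (f t)) a b HFf).
  assert (HCh : RInt F a m + RInt F m b = RInt F a b)
    by exact (RInt_Chasles F a m b HFam HFmb).
  rewrite <- HCh.
  rewrite <- (exp_ln (f m)) by (apply hpos; lra).
  replace (ln (f m)) with (F m) by (unfold F; rewrite clamp_id by lra; reflexivity).
  unfold Rpower; rewrite !ln_exp, <- !exp_plus.
  (* Both sides are now exponentials; [m - a = b - m = (b - a) / 2] turns the
     factor [(b - a) / 4] into the right normalisation. *)
  f_equal; unfold m; field; lra.
Qed.
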